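(* Let $A$ be an algebra. The mapping $\alpha\mapsto \mathcal U\{\alpha\}$ is a lattice isomorphism from the congruence lattice $\operatorname{Con} A$ onto a complete join subsemilattice of $\operatorname{Unif} A$ (the lattice of compatible uniformities of $A$).
   Context: A uniformity on a set $S$ is a filter $\mathcal U$ of binary relations on $S$ (closed under supersets and finite intersections) such that every $U\in\mathcal U$ is reflexive, $U\in\mathcal U$ implies $U^{-1}\in\mathcal U$, and for every $U\in\mathcal U$ there is $V\in\mathcal U$ with $V\circ V\subseteq U$. Uniformities are ordered by reverse inclusion: $\mathcal U_1\le\mathcal U_2$ iff $\mathcal U_2\subseteq\mathcal U_1$. An algebra $A$ has finitary basic operations; a uniformity on its underlying set is compatible if all basic operations are uniformly continuous. $\operatorname{Unif} A$ is the complete lattice of compatible uniformities on $A$, with this order. For a congruence $\alpha$ of $A$, $\mathcal U\{\alpha\}$ denotes the uniformity having $\{\alpha\}$ as a base, i.e. the set of all binary relations on $A$ that contain $\alpha$. ''Complete join subsemilattice'' means a subset closed under arbitrary joins of $\operatorname{Unif} A$. *)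

(* Defs.v *)
From HB Require Import structures.
From mathcomp Require Import all_boot all_order.
From mathcomp Require Import boolp classical_sets functions filter.

Set Implicit Arguments.
Unset Strict Implicit.
Unset Printing Implicit Defensive.

Local Open Scope classical_set_scope.
Local Open Scope relation_scope.

Record signature := Signature {
  op_symbol : Type;
  arity : op_symbol -> nat }.

Record algebra (Sg : signature) := Algebra {
  carrier :> Type;
  op : forall s : op_symbol Sg, ('I_(arity s) -> carrier) -> carrier }.
Arguments op {Sg} a s.

(** The conditions of [uniformity] are those which [uniformType] imposes on
    its [entourage]; the structure itself cannot be used because it attaches
    one fixed uniformity to a type. *)

Record uniformity (S : Type) (U : set_system (S * S)) : Prop := Uniformity {
  unif_filter : Filter U;
  unif_refl : forall E, U E -> diagonal `<=` E;
  unif_inv : forall E, U E -> U E^-1;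
  unif_split : forall E, U E -> exists2 V, U V & V \; V `<=` E }.

(* The product uniformity on S^n, every factor carrying U. *)
Definition power_entourage (S : Type) (U : set_system (S * S)) (n : nat) :
    set_system (('I_n -> S) * ('I_n -> S)) :=
  filter_from [set P : 'I_n -> set (S * S) | forall i, U (P i)]
    (fun P => [set xy | forall i, P i (xy.1 i, xy.2 i)]).
Arguments power_entourage {S} U n _.

Definition uniformly_continuous_op (S : Type) (U : set_system (S * S))
    (n : nat) (f : ('I_n -> S) -> S) : Prop :=
  (fun xy => (f xy.1, f xy.2)) @ power_entourage U n --> U.

Definition compatible_uniformity (Sg : signature) (A : algebra Sg)
    (U : set_system (A * A)) : Prop :=
  forall s, uniformly_continuous_op U (op A s).

Record congruence (Sg : signature) (A : algebra Sg) := Congruence {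
  con_rel : set (A * A);
  con_equiv : RelationClasses.Equivalence (fun x y => con_rel (x, y));
  con_op : forall s (x y : 'I_(arity s) -> A),
    (forall i, con_rel (x i, y i)) -> con_rel (op A s x, op A s y) }.

Fact con_display : Order.disp_t. Proof. exact: Order.Disp tt tt. Qed.

Section CongruenceLattice.
Context (Sg : signature) (A : algebra Sg).
Local Notation Con := (congruence A).
Implicit Types a b c : Con.

Lemma con_ext a b : con_rel a = con_rel b -> a = b.
Proof.
case: a b => [r e o] [r' e' o'] /= rr'; subst r'.
by rewrite (Prop_irrelevance e e') (Prop_irrelevance o o').
Qed.

HB.instance Definition _ := gen_eqMixin Con.
HB.instance Definition _ := gen_choiceMixin Con.

Definition con_le a b : bool := `[< con_rel a `<=` con_rel b >].

Lemma con_le_refl : reflexive con_le.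
Proof. by move=> a; apply/asboolP. Qed.

Lemma con_le_anti : antisymmetric con_le.
Proof.
by move=> a b /andP[/asboolP ab /asboolP ba]; apply/con_ext/seteqP.
Qed.

Lemma con_le_trans : transitive con_le.
Proof.
move=> b a c /asboolP ab /asboolP bc; apply/asboolP.
exact: subset_trans bc.
Qed.

HB.instance Definition _ := Order.Le_isPOrder.Build
  con_display Con con_le_refl con_le_anti con_le_trans.

Lemma con_leP a b : reflect (con_rel a `<=` con_rel b) (a <= b)%O.
Proof. exact: asboolP. Qed.

Definition con_Inf_rel (G : set Con) : set (A * A) :=
  [set xy | forall a, G a -> con_rel a xy].

Lemma con_Inf_equiv (G : set Con) :
  RelationClasses.Equivalence (fun x y => con_Inf_rel G (x, y)).
Proof.
split.
- by move=> x a _; case: (con_equiv a) => + _ _; apply.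
- by move=> x y xy a Ga; case: (con_equiv a) => _ + _; apply; apply: xy.
- move=> x y z xy yz a Ga; case: (con_equiv a) => _ _ tr.
  exact: tr (xy a Ga) (yz a Ga).
Qed.

Lemma con_Inf_op (G : set Con) s (x y : 'I_(arity s) -> A) :
  (forall i, con_Inf_rel G (x i, y i)) ->
  con_Inf_rel G (op A s x, op A s y).
Proof. by move=> xy a Ga; apply: con_op => i; apply: xy. Qed.

Definition con_Inf (G : set Con) : Con :=
  Congruence (con_Inf_equiv G) (@con_Inf_op G).

Definition con_meet a b : Con := con_Inf [set a; b].

Definition con_join a b : Con := con_Inf [set c | (a <= c)%O /\ (b <= c)%O].

Lemma con_meetP a b c : (a <= con_meet b c)%O = (a <= b)%O && (a <= c)%O.
Proof.
apply/con_leP/andP => [h|[/con_leP ab /con_leP ac] xy axy d [->|->]].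
- by split; apply/con_leP => xy /h; apply; [left|right].
- exact: ab.
- exact: ac.
Qed.

Lemma con_joinP a b c : (con_join a b <= c)%O = (a <= c)%O && (b <= c)%O.
Proof.
apply/con_leP/andP => [h|[ac bc] xy]; last by apply.
by split; apply/con_leP => xy axy; apply: h => d [/con_leP ? /con_leP ?]; auto.
Qed.

HB.instance Definition _ := Order.POrder_MeetJoin_isLattice.Build
  con_display Con con_meetP con_joinP.

End CongruenceLattice.

Record unif (Sg : signature) (A : algebra Sg) := Unif {
  entourages : set_system (A * A);
  unif_uniformity : uniformity entourages;
  unif_compatible : compatible_uniformity entourages }.

Arguments unif_compatible {Sg A} u s [_] _.

Fact unif_display : Order.disp_t. Proof. exact: Order.Disp tt tt. Qed.

Section UnifLattice.
Context (Sg : signature) (A : algebra Sg).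
Local Notation UnifA := (unif A).
Implicit Types U V W : UnifA.

Lemma unif_ext U V : entourages U = entourages V -> U = V.
Proof.
case: U V => [r e o] [r' e' o'] /= rr'; subst r'.
by rewrite (Prop_irrelevance e e') (Prop_irrelevance o o').
Qed.

HB.instance Definition _ := gen_eqMixin UnifA.
HB.instance Definition _ := gen_choiceMixin UnifA.

(* Reverse inclusion: finer uniformities are smaller. *)
Definition unif_le U V : bool := `[< entourages V `<=` entourages U >].

Lemma unif_le_refl : reflexive unif_le.
Proof. by move=> U; apply/asboolP. Qed.

Lemma unif_le_anti : antisymmetric unif_le.
Proof.
by move=> U V /andP[/asboolP UV /asboolP VU]; apply/unif_ext/seteqP.
Qed.

Lemma unif_le_trans : transitive unif_le.
Proof.
move=> V U W /asboolP UV /asboolP VW; apply/asboolP.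
exact: subset_trans UV.
Qed.

HB.instance Definition _ := Order.Le_isPOrder.Build
  unif_display UnifA unif_le_refl unif_le_anti unif_le_trans.

Lemma unif_leP U V : reflect (entourages V `<=` entourages U) (U <= V)%O.
Proof. exact: asboolP. Qed.

(* The meet is the uniformity generated by the union of U and V. *)
Definition unif_meet_entourages U V : set_system (A * A) :=
  [set E | exists E1 E2, [/\ entourages U E1, entourages V E2 &
                             E1 `&` E2 `<=` E]].

Lemma unif_meet_uniformity U V : uniformity (unif_meet_entourages U V).
Proof.
have [FU rU iU sU] := unif_uniformity U.
have [FV rV iV sV] := unif_uniformity V.
split.
- split.
  + by exists setT, setT; split => //; apply: filterT.
  + move=> E E' [E1 [E2 [h1 h2 h]]] [E1' [E2' [h1' h2' h']]].
    exists (E1 `&` E1'), (E2 `&` E2'); split; try exact: filterI.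
    by move=> xy [[? ?] [? ?]]; split; [apply: h|apply: h'].
  + move=> E E' EE' [E1 [E2 [h1 h2 h]]]; exists E1, E2; split => //.
    exact: subset_trans EE'.
- move=> E [E1 [E2 [h1 h2 h]]] xy dxy; apply: h.
  by split; [apply: rU dxy|apply: rV dxy].
- move=> E [E1 [E2 [h1 h2 h]]]; exists (E1^-1), (E2^-1).
  by split; [apply: iU|apply: iV|move=> xy [? ?]; apply: h].
- move=> E [E1 [E2 [/sU[V1 hV1 h1] /sV[V2 hV2 h2] h]]].
  exists (V1 `&` V2).
    by exists V1, V2; split => // ? [].
  move=> xy [z [z1 z2] [z3 z4]]; apply: h.
  by split; [apply: h1|apply: h2]; exists z.
Qed.

Lemma unif_meet_compatible U V :
  compatible_uniformity (unif_meet_entourages U V).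
Proof.
move=> s E [E1 [E2 [h1 h2 h]]].
have [P1 hP1 h1'] := unif_compatible U s h1.
have [P2 hP2 h2'] := unif_compatible V s h2.
exists (fun i => P1 i `&` P2 i).
  by move=> i; exists (P1 i), (P2 i); split; [apply: hP1|apply: hP2|].
move=> xy hxy; apply: h; split.
  by apply: h1' => i; case: (hxy i).
by apply: h2' => i; case: (hxy i).
Qed.

Definition unif_meet U V : UnifA :=
  Unif (unif_meet_uniformity U V) (@unif_meet_compatible U V).

Lemma unif_meetP U V W : (U <= unif_meet V W)%O = (U <= V)%O && (U <= W)%O.
Proof.
apply/unif_leP/andP => [h|[/unif_leP UV /unif_leP UW] E].
- split; apply/unif_leP => E hE; apply: h.
  + exists E, setT; split=> //.
    exact: @filterT _ _ (unif_filter (unif_uniformity W)).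
  + exists setT, E; split=> //.
    exact: @filterT _ _ (unif_filter (unif_uniformity V)).
- case=> E1 [E2 [/UV h1 /UW h2 h]].
  have FU := unif_filter (unif_uniformity U).
  by apply: filterS h _; apply: filterI.
Qed.

(* The family of upper bounds of F is directed downwards, so its union is
   again a compatible uniformity. *)
Definition unif_Sup_entourages (F : set UnifA) : set_system (A * A) :=
  [set E | exists2 W, ubound F W & entourages W E].

Lemma unif_Sup_uniformity (F : set UnifA) :
  uniformity (unif_Sup_entourages F).
Proof.
split.
- split.
  + pose T : set_system (A * A) := [set E | E = setT].
    have uT : uniformity T.
      split.
      * split=> //; first by move=> P Q -> ->; rewrite /T /= setIT.
        by move=> P Q PQ hP; apply/seteqP; split => // x _; apply: PQ; rewrite hP.
      * by move=> E ->.
      * by move=> E ->.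
      * by move=> E ->; exists setT.
    have cT : compatible_uniformity T.
      by move=> s E ->; exists (fun=> setT).
    exists (Unif uT cT) => //.
    move=> U _; apply/unif_leP => E ->.
    exact: @filterT _ _ (unif_filter (unif_uniformity U)).
  + move=> E E' [W hW WE] [W' hW' WE'].
    exists (unif_meet W W'); last by exists E, E'; split => // ? [].
    by move=> U FU; rewrite unif_meetP hW// hW'.
  + move=> E E' EE' [W hW WE]; exists W => //.
    have FW := unif_filter (unif_uniformity W).
    exact: filterS WE.
- by move=> E [W _ WE]; apply: unif_refl (unif_uniformity W) _ WE.
- move=> E [W hW WE]; exists W => //.
  exact: unif_inv (unif_uniformity W) _ WE.
- move=> E [W hW /(unif_split (unif_uniformity W))[D WD h]].
  by exists D => //; exists W.
Qed.

Lemma unif_Sup_compatible (F : set UnifA) :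
  compatible_uniformity (unif_Sup_entourages F).
Proof.
move=> s E [W hW WE].
have [P hP h] := unif_compatible W s WE.
by exists P => // i; exists W => //; apply: hP.
Qed.

Definition unif_Sup (F : set UnifA) : UnifA :=
  Unif (unif_Sup_uniformity F) (@unif_Sup_compatible F).

Lemma unif_SupP (F : set UnifA) : supremums F (unif_Sup F).
Proof.
split=> [U FU|W hW]; apply/unif_leP => E.
- by case=> W /(_ U FU) /unif_leP; apply.
- by exists W.
Qed.

Definition unif_join U V : UnifA := unif_Sup [set U; V].

Lemma unif_joinP U V W : (unif_join U V <= W)%O = (U <= W)%O && (V <= W)%O.
Proof.
have [hub hlub] := unif_SupP [set U; V].
apply/idP/andP => [h|[UW VW]]; last by apply: hlub => X [->|->].
by split; apply: Order.POrderTheory.le_trans h; apply: hub; [left|right].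
Qed.

HB.instance Definition _ := Order.POrder_MeetJoin_isLattice.Build
  unif_display UnifA unif_meetP unif_joinP.

(* Joins are those of Unif A; the case of empty F puts the bottom of Unif A
   into L. *)
Definition complete_join_subsemilattice (L : set UnifA) : Prop :=
  forall F : set UnifA, F `<=` L -> L (unif_Sup F).

End UnifLattice.

Section UnifOfCongruence.
Context (Sg : signature) (A : algebra Sg) (a : congruence A).

Definition con_entourages : set_system (A * A) := [set E | con_rel a `<=` E].

Lemma con_entourages_uniformity : uniformity con_entourages.
Proof.
have [r s t] := con_equiv a.
split.
- split=> //; first by move=> P Q hP hQ xy h; split; [apply: hP|apply: hQ].
  by move=> P Q PQ hP; apply: subset_trans PQ.
- by move=> E aE [x y] /= xy; have -> : x = y := xy; apply: aE; apply: r.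
- by move=> E aE [x y] xy; apply: aE; apply: s.
- move=> E aE; exists (con_rel a) => //.
  by move=> [x y] [z xz zy]; apply: aE; apply: t xz zy.
Qed.

Lemma con_entourages_compatible : compatible_uniformity con_entourages.
Proof.
move=> s E aE; exists (fun=> con_rel a) ; first by move=> i.
by move=> xy hxy; apply: aE; apply: con_op.
Qed.

Definition unif_of_con : unif A :=
  Unif con_entourages_uniformity con_entourages_compatible.

End UnifOfCongruence.

(** The set L carries the induced order, and its joins and meets are taken
    within L; they need not be those of the ambient poset. *)

Section IsoOnto.
Context {d d' : Order.disp_t} {X : latticeType d} {T : porderType d'}.
Implicit Types (L : set T) (x y z : T).

Definition is_join_in L x y z : Prop :=
  [/\ L z, (x <= z)%O, (y <= z)%O &
      forall w, L w -> (x <= w)%O -> (y <= w)%O -> (z <= w)%O].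

Definition is_meet_in L x y z : Prop :=
  [/\ L z, (z <= x)%O, (z <= y)%O &
      forall w, L w -> (w <= x)%O -> (w <= y)%O -> (w <= z)%O].

Definition lattice_isomorphism_onto (f : X -> T) L : Prop :=
  [/\ set_bij setT L f,
      forall a b, is_join_in L (f a) (f b) (f (Order.join a b)) &
      forall a b, is_meet_in L (f a) (f b) (f (Order.meet a b))].

End IsoOnto.

(* Main.v *)
Require Import Defs.
From mathcomp Require Import all_boot all_order.
From mathcomp Require Import boolp classical_sets functions.

Import Order.TTheory.

Local Open Scope classical_set_scope.

(** The intersection of all entourages of a compatible uniformity W is a
    congruence, the largest one whose uniformity lies below W.  Hence
    W |-> con_of_unif W is right adjoint to a |-> U{a}, so the latter preserves
    arbitrary joins; it is also an order embedding. *)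

Lemma unif_of_con_le (Sg : signature) (A : algebra Sg) (a b : congruence A) :
  (unif_of_con a <= unif_of_con b)%O = (a <= b)%O.
Proof.
(* [con_rel b] is the least entourage of [unif_of_con b], so testing it suffices. *)
apply/unif_leP/con_leP => [ba|ab E bE]; first exact: (ba (con_rel b)).
exact: subset_trans bE.
Qed.

Lemma unif_of_con_inj (Sg : signature) (A : algebra Sg) :
  injective (@unif_of_con Sg A).
Proof. by move=> a b ab; apply/le_anti; rewrite -!unif_of_con_le ab lexx. Qed.

Definition con_of_unif_rel {Sg : signature} {A : algebra Sg} (W : unif A) :
    set (A * A) :=
  [set xy | forall E, entourages W E -> E xy].

Lemma con_of_unif_equiv (Sg : signature) (A : algebra Sg) (W : unif A) :
  RelationClasses.Equivalence (fun x y => con_of_unif_rel W (x, y)).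
Proof.
have [_ rW iW sW] := unif_uniformity W.
split.
- by move=> x E WE; apply: rW WE _ _.
- by move=> x y xy E /iW /xy.
- by move=> x y z xy yz E /sW[V WV]; apply; exists y; [apply: xy|apply: yz].
Qed.

(** Uniform continuity at [E] asks each pair [(x i, y i)] to lie in some entourage [P i]; these
    pairs lie in all of them. *)
Lemma con_of_unif_op (Sg : signature) (A : algebra Sg) (W : unif A)
    (s : op_symbol Sg) (x y : 'I_(arity s) -> A) :
  (forall i, con_of_unif_rel W (x i, y i)) ->
  con_of_unif_rel W (op A s x, op A s y).
Proof.
move=> xy E /(unif_compatible W s)[P WP PE].
by apply: (PE (x, y)) => i; apply: xy; apply: WP.
Qed.

Definition con_of_unif {Sg : signature} {A : algebra Sg} (W : unif A) :
    congruence A :=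
  @Congruence _ _ _ (@con_of_unif_equiv _ _ W) (@con_of_unif_op _ _ W).

(** Both sides say that every entourage of [W] contains [con_rel a]. *)
Lemma unif_of_con_leE (Sg : signature) (A : algebra Sg)
    (a : congruence A) (W : unif A) :
  (unif_of_con a <= W)%O = (a <= con_of_unif W)%O.
Proof.
apply/unif_leP/con_leP => [Wa xy axy E /Wa|aW E WE xy /aW]; first exact.
exact.
Qed.

Lemma unif_Sup_of_con (Sg : signature) (A : algebra Sg)
    (G : set (congruence A)) :
  unif_Sup (@unif_of_con Sg A @` G) = unif_of_con (con_Inf (ubound G)).
Proof.
have [ubS lubS] := unif_SupP (@unif_of_con Sg A @` G).
apply/le_anti/andP; split.
  apply: lubS => _ [a Ga <-]; rewrite unif_of_con_le.
  by apply/con_leP => xy axy b /(_ a Ga) /con_leP; apply.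
(* By adjunction, the congruence of the supremum is an upper bound of [G], hence contains the least
   one. *)
rewrite unif_of_con_leE; apply/con_leP => xy; apply=> a Ga.
by rewrite -unif_of_con_leE; apply: ubS; exists a.
Qed.

Theorem theorem5p2 (Sg : signature) (A : algebra Sg) :
  exists L : set (unif A),
    complete_join_subsemilattice L /\
    lattice_isomorphism_onto (@unif_of_con Sg A) L.
Proof.
exists (range (@unif_of_con Sg A)); split.
  move=> F FL; pose G := @unif_of_con Sg A @^-1` F.
  have -> : F = @unif_of_con Sg A @` G.
    apply/seteqP; split=> [U FU|_ [a Fa <-]//].
    by have [a _ aU] := FL U FU; exists a; rewrite // /G /= aU.
  by rewrite unif_Sup_of_con; exists (con_Inf (ubound G)).
split.
- split=> [a _||//]; first by exists a.
  by move=> a b _ _ /unif_of_con_inj.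
(* Competing bounds in [L] are images of congruences, so the order embedding reduces joins and meets
   in [L] to those of congruences. *)
- move=> a b; split; rewrite ?unif_of_con_le ?leUl ?leUr //.
  by move=> _ [c _ <-]; rewrite !unif_of_con_le leUx => -> ->.
- move=> a b; split; rewrite ?unif_of_con_le ?leIl ?leIr //.
  by move=> _ [c _ <-]; rewrite !unif_of_con_le lexI => -> ->.
Qed.
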